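(* Let $A$ be an integral domain, $E$ an $A$-module, and $N\subseteq qD_A(E)$ a subset. Then the closure and the interior of $N$ in $qD_A(E)$ are $$\overline{N}=\{[a]\in\operatorname{EC}(W(E)^{\#}): U_b\subseteq U_a\text{ for some }[b]\in N\},\qquad N^{\circ}=\{[a]\in N: U_a\subseteq N\}.$$ In particular, $\overline{\{[a]\}}=\{[b]\in\operatorname{EC}(W(E)^{\#}): bE\subseteq aE\}$ for every $[a]\in\operatorname{EC}(W(E)^{\#})$.
   Context: For an $A$-module $E$: $\operatorname{ann}(E)=\{a\in A: aE=0\}$, $W(E)=\{a\in A: aE\neq E\}$, $W(E)^{\#}=W(E)\setminus\operatorname{ann}(E)$. On $W(E)^{\#}$ put $a\sim b$ iff $aE=bE$; $[a]$ is the class of $a$ and $\operatorname{EC}(W(E)^{\#})$ is the set of all classes. For $a\in W(E)^{\#}$, $U_a=\{[b]\in\operatorname{EC}(W(E)^{\#}): aE\subseteq bE\}$. The quasi divisor topology $qD_A(E)$ is the topological space $\operatorname{EC}(W(E)^{\#})$ whose topology has basis $\{U_a\}_{a\in W(E)^{\#}}$. *)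

(* Defs.v *)
From HB Require Import structures.
From mathcomp Require Import all_boot all_algebra generic_quotient.
From mathcomp Require Import all_classical topology.

Set Implicit Arguments.
Unset Strict Implicit.
Unset Printing Implicit Defensive.

Import GRing.Theory.
Local Open Scope ring_scope.
Local Open Scope classical_set_scope.
Local Open Scope quotient_scope.

Definition mulmod (A : idomainType) (E : lmodType A) (a : A) : set E :=
  [set a *: e | e in [set: E]].
Arguments mulmod {A} E a.

Definition ann (A : idomainType) (E : lmodType A) : set A :=
  [set a | mulmod E a = [set 0]].

Definition Wset (A : idomainType) (E : lmodType A) : set A :=
  [set a | mulmod E a <> [set: E]].

Definition Wsharp (A : idomainType) (E : lmodType A) : set A :=
  Wset E `\` ann E.

Definition sim (A : idomainType) (E : lmodType A) :
    rel (set_type (Wsharp E)) :=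
  fun a b => `[< mulmod E (val a) = mulmod E (val b) >].
Arguments sim {A} E a b.

Lemma sim_refl (A : idomainType) (E : lmodType A) : reflexive (sim E).
Proof. by move=> a; apply/asboolP. Qed.

Lemma sim_sym (A : idomainType) (E : lmodType A) : symmetric (sim E).
Proof. by move=> a b; apply/asboolP/asboolP => ->. Qed.

Lemma sim_trans (A : idomainType) (E : lmodType A) : transitive (sim E).
Proof. by move=> b a c /asboolP ab /asboolP bc; apply/asboolP; rewrite ab. Qed.

Canonical sim_equiv (A : idomainType) (E : lmodType A) : equiv_rel _ :=
  EquivRel (sim E) (@sim_refl A E) (@sim_sym A E) (@sim_trans A E).

(* The set EC(W(E)^#) of classes, as a quotient type; it is empty when W(E)^#
   is, so the space below is not required to be pointed. *)
Definition qD (A : idomainType) (E : lmodType A) : Type :=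
  {eq_quot (sim_equiv E)}.

HB.instance Definition _ (A : idomainType) (E : lmodType A) :=
  Choice.copy (qD E) {eq_quot (sim_equiv E)}.

Definition cls (A : idomainType) (E : lmodType A)
    (a : set_type (Wsharp E)) : qD E :=
  \pi_({eq_quot (sim_equiv E)}) a.

Lemma clsP (A : idomainType) (E : lmodType A) (a b : set_type (Wsharp E)) :
  cls a = cls b <-> mulmod E (val a) = mulmod E (val b).
Proof.
split=> [/(@eqmodP _ (sim_equiv E) a b)/asboolP //|ab].
by apply/(@eqmodP _ (sim_equiv E) a b)/asboolP.
Qed.

Lemma cls_surj (A : idomainType) (E : lmodType A) (x : qD E) :
  exists a, x = cls a.
Proof. by exists (repr (x : {eq_quot (sim_equiv E)})); rewrite /cls reprK. Qed.

Definition basicU (A : idomainType) (E : lmodType A)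
    (a : set_type (Wsharp E)) : set (qD E) :=
  [set cls b | b in [set b | mulmod E (val a) `<=` mulmod E (val b)]].

Lemma basicU_cls (A : idomainType) (E : lmodType A)
    (a b : set_type (Wsharp E)) :
  basicU a (cls b) <-> mulmod E (val a) `<=` mulmod E (val b).
Proof. by split=> [[c ac /clsP <-] //|ab]; exists b. Qed.

Lemma basicU_cover (A : idomainType) (E : lmodType A) :
  \bigcup_(V in range (@basicU A E)) V = [set: qD E].
Proof.
apply/seteqP; split=> // x _; have [a ->] := cls_surj x.
by exists (basicU a); [exists a | apply/basicU_cls].
Qed.

Lemma basicU_join (A : idomainType) (E : lmodType A)
    (V V' : set (qD E)) (x : qD E) :
  range (@basicU A E) V -> range (@basicU A E) V' -> V x -> V' x ->
  exists V'', [/\ range (@basicU A E) V'', V'' x & V'' `<=` V `&` V'].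
Proof.
move=> [a _ <-] [b _ <-]; have [c ->] := cls_surj x.
move=> /basicU_cls ac /basicU_cls bc; exists (basicU c); split.
- by exists c.
- exact/basicU_cls.
- move=> y; have [d ->] := cls_surj y => /basicU_cls cd.
  split; apply/basicU_cls;
    by [apply: subset_trans ac cd|apply: subset_trans bc cd].
Qed.

HB.instance Definition _ (A : idomainType) (E : lmodType A) :=
  isBaseTopological.Build (qD E) (@basicU_cover A E) (@basicU_join A E).

Lemma openqDE (A : idomainType) (E : lmodType A) :
  @open (qD E) =
  [set \bigcup_(V in B) V | B in [set B | B `<=` range (@basicU A E)]].
Proof. by []. Qed.

(* Main.v *)
Require Import Defs.
From mathcomp Require Import all_boot all_algebra.
From mathcomp Require Import all_classical topology.

Local Open Scope classical_set_scope.

(** The space of classes is an Alexandrov space: the sets [U_a] that contain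
    [[c]] are those with [aE] included in [cE], so they all contain [U_c], and
    [U_c] is the least neighbourhood of [[c]] ([nbhs_cls]). Hence [[c]] is
    interior to [N] exactly when [U_c] is included in [N], and adherent to [N]
    exactly when [U_c] meets [N], that is when [cE] is included in [bE] for
    some [[b]] in [N] ([closure_cls]). Since [a |-> U_a] reverses the inclusion
    of the submodules [aE] ([basicU_subset]), the latter condition is the
    inclusion of [U_b] in [U_c]. *)

Lemma basicU_subset (A : idomainType) (E : lmodType A)
    (a b : set_type (Wsharp E)) :
  basicU b `<=` basicU a <-> mulmod E (val a) `<=` mulmod E (val b).
Proof.
split=> [ba|ab x]; first by apply/basicU_cls/ba/basicU_cls.
have [c ->] := cls_surj x => /basicU_cls bc.
by apply/basicU_cls; apply: subset_trans bc.
Qed.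

(** An open neighbourhood of a class contains a basic set [U_b] to which the
    class belongs, and [U_b] contains [U_a] because the inclusion of [bE] in
    [aE] can be composed with that of [aE] in any larger [cE]. *)
Lemma nbhs_cls (A : idomainType) (E : lmodType A) (a : set_type (Wsharp E))
    (V : set (qD E)) :
  nbhs (cls a) V <-> basicU a `<=` V.
Proof.
rewrite nbhsE; split=> [[O [oO Oa] OV]|aV].
  move: oO Oa OV; rewrite openqDE => -[B Bbase <-] [U BU Ua] OV x ax.
  apply: OV; exists U => //; have [b _ bU] := Bbase U BU.
  rewrite -bU in Ua *; have /basicU_cls ba := Ua.
  by have /basicU_subset := ba; apply.
exists (basicU a) => //; split; last exact/basicU_cls.
rewrite openqDE; exists [set basicU a]; last by rewrite bigcup_set1.
by move=> _ ->; exists a.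
Qed.

Lemma closure_cls (A : idomainType) (E : lmodType A) (N : set (qD E))
    (a : set_type (Wsharp E)) :
  closure N (cls a) <->
  exists2 b, N (cls b) & mulmod E (val a) `<=` mulmod E (val b).
Proof.
split=> [Na|[b Nb ab] V /nbhs_cls aV].
  have /Na[x [Nx]] : nbhs (cls a) (basicU a) by apply/nbhs_cls.
  by have [b xb] := cls_surj x; rewrite xb in Nx * => /basicU_cls; exists b.
by exists (cls b); split=> //; apply/aV/basicU_cls.
Qed.

Theorem proposition4 (A : idomainType) (E : lmodType A) (N : set (qD E)) :
  closure N = [set cls a | a in
    [set a : set_type (Wsharp E) |
      exists b : set_type (Wsharp E), N (cls b) /\ basicU b `<=` basicU a]] /\
  N° = [set cls a | a in
    [set a : set_type (Wsharp E) | N (cls a) /\ basicU a `<=` N]] /\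
  (forall a : set_type (Wsharp E),
    closure [set cls a] = [set cls b | b in
      [set b : set_type (Wsharp E) | mulmod E (val b) `<=` mulmod E (val a)]]).
Proof.
split; [|split=> [|a]]; apply/seteqP; split=> x.
- have [a ->] := cls_surj x => /closure_cls[b Nb ab].
  by exists a => //; exists b; split=> //; apply/basicU_subset.
- by case=> a [b [Nb /basicU_subset ab]] <-; apply/closure_cls; exists b.
- have [a ->] := cls_surj x => /nbhs_cls aN.
  by exists a => //; split=> //; apply/aN/basicU_cls.
- by case=> a [_ aN] <-; apply/nbhs_cls.
- have [b ->] := cls_surj x => /closure_cls[c /clsP ca bc].
  by exists b => //=; rewrite -ca.
- by case=> b ba <-; apply/closure_cls; exists a.
Qed.
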